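(* Let $\bar x\in\mathcal{F}$ and assume that $\bar x$ satisfies the limiting constraint qualification (LCQ). If $\bar x$ is a type-2 $\mathcal{E}$-quasi-weakly Pareto solution of (SIVP), then there exist $\lambda^L=(\lambda^L_1,\ldots,\lambda^L_m),\ \lambda^U=(\lambda^U_1,\ldots,\lambda^U_m)\in \mathbb{R}^m_+$ with $\sum_{i\in I}(\lambda^L_i+\lambda^U_i)=1$, and $\mu\in A(\bar x)$ such that $$0\in \sum_{i\in I} \left[\lambda^L_i\partial f^L_i(\bar x)+\lambda^U_i\partial f_i^U(\bar x)\right] +\sum_{t\in T}\mu_t\partial g_t(\bar x)+\sum_{i\in I}\left(\lambda^L_i\epsilon^U_i+\lambda^U_i\epsilon^L_i\right)\mathbb{B}_{\mathbb{R}^n}+N(\bar x; \Omega).$$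
   Context: **Generalized differentiation.** $\mathbb{R}^n$ carries the usual scalar product and Euclidean norm; $\mathbb{B}_{\mathbb{R}^n}$ is its closed unit ball; $\mathbb{R}^m_+$ is the nonnegative orthant. For $S\subset\mathbb{R}^n$, $x\in S$ and $\varepsilon\ge 0$, let $\widehat N_\varepsilon(x;S)=\{z^*\in\mathbb{R}^n : \limsup_{u\to x,\,u\in S}\frac{\langle z^*,u-x\rangle}{\|u-x\|}\le\varepsilon\}$. The Mordukhovich (limiting) normal cone of $S$ at $\bar x\in\mathrm{cl}\,S$ is $$N(\bar x;S)=\{z^*\in\mathbb{R}^n : \exists\, x^k\to\bar x \text{ with } x^k\in S,\ \varepsilon_k\to0^+,\ z_k^*\to z^*,\ z^*_k\in\widehat N_{\varepsilon_k}(x^k;S)\ \forall k\in\mathbb{N}\}.$$ The Mordukhovich (limiting) subdifferential of $\varphi:\mathbb{R}^n\to\mathbb{R}$ at $\bar x$ is $\partial\varphi(\bar x)=\{x^*\in\mathbb{R}^n : (x^*,-1)\in N((\bar x,\varphi(\bar x));\mathrm{epi}\,\varphi)\}$, where $\mathrm{epi}\,\varphi=\{(x,\alpha)\in\mathbb{R}^n\times\mathbb{R}:\alpha\ge\varphi(x)\}$. **Intervals.** $\mathcal{K}_c$ is the set of closed bounded intervals $[a^L,a^U]$, $a^L\le a^U$, in $\mathbb{R}$. For $A=[a^L,a^U]$, $B=[b^L,b^U]$: $A-B=[a^L-b^U,a^U-b^L]$; $kA=[ka^L,ka^U]$ for $k\ge0$. Also, $A<^s_{LU}B$ means $a^L<b^L$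 and $a^U<b^U$. **Problem.** $I=\{1,\ldots,m\}$. For $i\in I$, $f_i:\mathbb{R}^n\to\mathcal{K}_c$, $f_i(x)=[f_i^L(x),f_i^U(x)]$, where $f_i^L,f_i^U:\mathbb{R}^n\to\mathbb{R}$ are locally Lipschitz with $f_i^L\le f_i^U$ on $\mathbb{R}^n$. $T$ is an arbitrary (possibly infinite) index set, $g_t:\mathbb{R}^n\to\mathbb{R}$ ($t\in T$) are locally Lipschitz, and $\Omega\subset\mathbb{R}^n$ is nonempty and closed. Problem (SIVP) is to minimize, in the lower-upper (LU) interval order sense, $f=(f_1,\ldots,f_m)$ over the feasible set $\mathcal{F}=\{x\in\Omega : g_t(x)\le0,\ t\in T\}$. Fix reals $0\le\epsilon_i^L\le\epsilon_i^U$ ($i\in I$), $\mathcal{E}_i=[\epsilon_i^L,\epsilon_i^U]$, $\mathcal{E}=(\mathcal{E}_1,\ldots,\mathcal{E}_m)$. **Multipliers.** $\mathbb{R}_+^{|T|}$ is the set of functions $\mu:T\to\mathbb{R}_+$, $\mu_t=\mu(t)$, that vanish at all but finitely many $t\in T$. For $\bar x\in\Omega$, $A(\bar x)=\{\mu\in\mathbb{R}_+^{|T|} : \mu_tg_t(\bar x)=0\ \forall t\in T\}$. **Solution.** $\bar x\in\mathcal{F}$ is a type-2 $\mathcal{E}$-quasi-weakly Pareto solution of (SIVP) if there is no $x\in\mathcal{F}$ with $f_i(x)<^s_{LU}f_i(\bar x)-\mathcal{E}_i\|x-\bar x\|$ for all $i\in I$. **(LCQ).** $\bar x\in\mathcal{F}$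 satisfies the limiting constraint qualification if $$N(\bar x;\mathcal{F})\subseteq\bigcup_{\mu\in A(\bar x)}\Big[\sum_{t\in T}\mu_t\partial g_t(\bar x)\Big]+N(\bar x;\Omega).$$ *)

(* Defs.v *)
From mathcomp Require Import all_boot all_order all_algebra.
From mathcomp Require Import all_classical all_reals all_analysis.

Set Implicit Arguments.
Unset Strict Implicit.
Unset Printing Implicit Defensive.

Import Order.TTheory GRing.Theory Num.Theory.
Import numFieldNormedType.Exports.

Local Open Scope classical_set_scope.
Local Open Scope ring_scope.

Section Euclidean.
Context {R : realType} {n : nat}.
Implicit Types u v : 'rV[R]_n.

Definition dotv u v : R := \sum_(i < n) u 0 i * v 0 i.

(* The library norm of 'rV[R]_n is the max norm; the Euclidean norm is used
   below, while limits and neighbourhoods are those of the library topology,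
   which is the same for both norms. *)
Definition enorm u : R := Num.sqrt (dotv u u).

Lemma enorm_ge0 u : 0 <= enorm u.
Proof. exact: sqrtr_ge0. Qed.

Definition enorm_nng u : {nonneg R} := NngNum (enorm_ge0 u).

Definition eball : set 'rV[R]_n := [set u | enorm u <= 1].

Definition locally_lipschitz (phi : 'rV[R]_n -> R) : Prop :=
  forall x : 'rV[R]_n, exists k : R,
    \forall u & v \near x, `|phi u - phi v| <= k * enorm (u - v).

End Euclidean.
Arguments eball R n : clear implicits.

Reserved Notation "A [+] B" (at level 50, left associativity).
Reserved Notation "k [*:] A" (at level 40, left associativity).

Definition set_add {R : realType} {V : lmodType R} (A B : set V) : set V :=
  [set a + b | a in A & b in B].
Notation "A [+] B" := (set_add A B) : classical_set_scope.

Definition set_scale {R : realType} {V : lmodType R} (k : R) (A : set V) :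
    set V :=
  [set k *: a | a in A].
Notation "k [*:] A" := (set_scale k A) : classical_set_scope.

Section GeneralizedDifferentiation.
Context {R : realType}.

(* The limit superior is over u in S tending to x with u different from x;
   at an isolated point of S it is -oo. *)
Definition eps_normals {n} (e : R) (x : 'rV[R]_n) (S : set 'rV[R]_n) :
    set 'rV[R]_n :=
  [set z : 'rV[R]_n |
    (limf_esup (fun u : 'rV[R]_n => (dotv z (u - x) / enorm (u - x))%:E)
       (within S x^') <= e%:E)%E].

Definition normal_cone {n} (x : 'rV[R]_n) (S : set 'rV[R]_n) : set 'rV[R]_n :=
  [set z : 'rV[R]_n | exists (x_ : nat -> 'rV[R]_n) (e_ : nat -> R) (z_ : nat -> 'rV[R]_n),
    [/\ x_ @ \oo --> x /\ (forall k, S (x_ k)),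
        e_ @ \oo --> (0 : R) /\ (forall k, 0 < e_ k),
        z_ @ \oo --> z &
        forall k, eps_normals (e_ k) (x_ k) S (z_ k)]].

(* R^n x R is identified with R^(n+1), so that it carries the Euclidean norm. *)
Definition pairv {n} (x : 'rV[R]_n) (a : R) : 'rV[R]_(n + 1) :=
  row_mx x a%:M.

Definition epi {n} (phi : 'rV[R]_n -> R) : set 'rV[R]_(n + 1) :=
  [set pairv p.1 p.2 | p in [set p : 'rV[R]_n * R | phi p.1 <= p.2]].

Definition subdiff {n} (phi : 'rV[R]_n -> R) (x : 'rV[R]_n) : set 'rV[R]_n :=
  [set z : 'rV[R]_n | normal_cone (pairv x (phi x)) (epi phi) (pairv z (-1))].

End GeneralizedDifferentiation.

Section Intervals.
Context {R : realType}.

(* A closed bounded interval is given by its ordered endpoints. *)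
Record cinterval := CInterval { lo : R; hi : R; lo_le_hi : lo <= hi }.
Implicit Types A B : cinterval.

Lemma isub_subproof A B : lo A - hi B <= hi A - lo B.
Proof. by rewrite lerB ?lo_le_hi. Qed.

Definition isub A B : cinterval := CInterval (isub_subproof A B).

Lemma iscale_subproof (k : {nonneg R}) A : k%:num * lo A <= k%:num * hi A.
Proof. by rewrite ler_wpM2l ?lo_le_hi. Qed.

Definition iscale (k : {nonneg R}) A : cinterval :=
  CInterval (iscale_subproof k A).

Definition ltsLU A B : Prop := lo A < lo B /\ hi A < hi B.

End Intervals.
Arguments cinterval R : clear implicits.

Section Problem.
Context {R : realType} {n m : nat} {T : Type}.
Variables (f : 'I_m -> 'rV[R]_n -> cinterval R) (g : T -> 'rV[R]_n -> R).
Variables (Omega : set 'rV[R]_n) (E : 'I_m -> cinterval R).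

Definition feasible : set 'rV[R]_n :=
  [set x | Omega x /\ forall t, g t x <= 0].

Definition type2_quasi_weakly_pareto (xbar : 'rV[R]_n) : Prop :=
  feasible xbar /\
  ~ exists x, feasible x /\
      forall i, ltsLU (f i x)
                  (isub (f i xbar) (iscale (enorm_nng (x - xbar)) (E i))).

Definition multipliers : set (T -> R) :=
  [set mu | (forall t, 0 <= mu t) /\ finite_set [set t | mu t != 0]].

Definition active_multipliers (xbar : 'rV[R]_n) : set (T -> R) :=
  [set mu | multipliers mu /\ forall t, mu t * g t xbar = 0].

(* The finite Minkowski sum of the mu_t * subdiff (g t) xbar over the t with
   mu_t <> 0; it is {0} when mu = 0.  The alias {classic T} only supplies the
   choiceType structure required by finitely supported big operators. *)
Definition sum_subdiff (mu : T -> R) (xbar : 'rV[R]_n) : set 'rV[R]_n :=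
  \big[set_add/[set 0]]_(t \in [set t : {classic T} | mu t != 0])
    (mu t [*:] subdiff (g t) xbar).

Definition LCQ (xbar : 'rV[R]_n) : Prop :=
  normal_cone xbar feasible `<=`
  (\bigcup_(mu in active_multipliers xbar) sum_subdiff mu xbar) [+]
  normal_cone xbar Omega.

End Problem.

(* Main.v *)
Require Import Defs.
From mathcomp Require Import all_boot all_order all_algebra.
From mathcomp Require Import ring lra.
From mathcomp Require Import all_classical all_reals all_analysis.

Import Order.TTheory GRing.Theory Num.Theory.
Import numFieldNormedType.Exports.

Local Open Scope classical_set_scope.
Local Open Scope ring_scope.

(** Over the feasible set F, [xbar] minimizes the largest of the 2m functions
    [phi_j x - phi_j xbar + r_j |x - xbar|], where [phi_j] runs through the
    lower endpoints, with [r_j] the upper endpoint of the interval [E i], and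
    the upper endpoints, with [r_j] the lower endpoint of [E i]: a feasible
    point at which all of them are negative is exactly a point that beats
    [xbar] in the type-2 sense, and all of them vanish at [xbar].  A Lagrange
    multiplier rule for such a nonsmooth minimax problem over an abstract
    closed set ([multiplier_rule]) yields multipliers, elements of the scaled
    subdifferentials, a vector of the unit ball and a limiting normal to F
    that add up to 0; the constraint qualification then splits that normal.

    The multiplier rule is proved without the calculus of limiting
    subdifferentials.  Each function gets its own copy [y j] of the variable,
    the copies are tied to x by a quadratic penalty, the norm is smoothed, and
    the maximum is replaced by the sum of squared positive parts of the
    functions shifted up by a small e > 0.  A minimizer of this [penalty]
    exists by compactness.  Since the penalty is majorized by quadratics,
    minimality in [y j] is a proximal normal inequality to the epigraph of
    [phi_j], and minimality in x is one to F
    ([proximal_normal_epi], [proximal_normal_feasible]).  The positive parts,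
    divided by their sum, are the multipliers.  All error terms are of smaller
    order than that sum ([exists_approximate_multipliers]), so a cluster point
    of these data as e tends to 0 gives the exact rule
    ([exists_limiting_multipliers]).  The Lipschitz constants keep the data
    bounded and make the normal vector vanish along with its multiplier
    ([proximal_normal_epi_le]).  A vanishing multiplier still requires some
    element of the subdifferential; one comes from applying the same rule to a
    single function over the singleton of [xbar] ([subdiff_nonempty]). *)

(** * Euclidean inner product and norm *)

Lemma cvg_sum {R : realType} {V : normedModType R} {U : Type} (J : finType)
    (F : set_system U) {FF : Filter F} (f : J -> U -> V) (a : J -> V) :
  (forall j, f j u @[u --> F] --> a j) ->
  \sum_j f j u @[u --> F] --> \sum_j a j.
Proof.
by move=> fa; apply: cvg_big => [|j _]; [exact: add_continuous|exact: fa].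
Qed.

Section EuclideanSpace.
Context {R : realType} {n : nat}.
Implicit Types (u v w : 'rV[R]_n) (c : R).

Lemma dotvC u v : dotv u v = dotv v u.
Proof. by apply: eq_bigr => i _; rewrite mulrC. Qed.

Lemma dotvDr w u v : dotv w (u + v) = dotv w u + dotv w v.
Proof. by rewrite -big_split; apply: eq_bigr => i _; rewrite mxE mulrDr. Qed.

Lemma dotvZr c w u : dotv w (c *: u) = c * dotv w u.
Proof. by rewrite mulr_sumr; apply: eq_bigr => i _; rewrite mxE mulrCA. Qed.

Lemma dotvDl w u v : dotv (u + v) w = dotv u w + dotv v w.
Proof. by rewrite dotvC dotvDr !(dotvC w). Qed.

Lemma dotvZl c w u : dotv (c *: u) w = c * dotv u w.
Proof. by rewrite dotvC dotvZr dotvC. Qed.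

Lemma dotvNr w u : dotv w (- u) = - dotv w u.
Proof. by rewrite -scaleN1r dotvZr mulN1r. Qed.

Lemma dotvNl w u : dotv (- u) w = - dotv u w.
Proof. by rewrite dotvC dotvNr dotvC. Qed.

Lemma dotv_suml (J : finType) (F : J -> 'rV[R]_n) w :
  dotv (\sum_j F j) w = \sum_j dotv (F j) w.
Proof.
rewrite /dotv exchange_big; apply: eq_bigr => i _ /=.
by rewrite summxE mulr_suml.
Qed.

Definition dotvE := (dotvDr, dotvDl, dotvNr, dotvNl, dotvZr, dotvZl).

Lemma dotv_ge0 u : 0 <= dotv u u.
Proof. by apply: sumr_ge0 => i _; rewrite -expr2 sqr_ge0. Qed.

Lemma dotvD_sq u v :
  dotv (u + v) (u + v) = dotv u u + 2 * dotv u v + dotv v v.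
Proof. rewrite !dotvE (dotvC v u); ring. Qed.

Lemma sqr_enorm u : enorm u ^+ 2 = dotv u u.
Proof. by rewrite sqr_sqrtr ?dotv_ge0. Qed.

Lemma enorm0 : enorm (0 : 'rV[R]_n) = 0.
Proof. by rewrite /enorm /dotv big1 ?sqrtr0// => i _; rewrite mxE mul0r. Qed.

Lemma enormZ c u : enorm (c *: u) = `|c| * enorm u.
Proof.
by rewrite /enorm dotvZl dotvZr mulrA -expr2 sqrtrM ?sqr_ge0// sqrtr_sqr.
Qed.

Lemma le_norm_enorm u : `|u| <= enorm u.
Proof.
rewrite [leLHS]/Num.norm/= mx_normrE; apply/bigmax_leP; split => [|[i j] _].
  exact: enorm_ge0.
rewrite /= ord1 -(sqrtr_sqr (u 0 j)) ler_sqrt ?dotv_ge0// expr2 /dotv.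
rewrite (bigD1 j)//= lerDl; apply: sumr_ge0 => k _.
by rewrite -expr2 sqr_ge0.
Qed.

Lemma enorm_eq0 u : enorm u = 0 -> u = 0.
Proof.
by move=> u0; apply/eqP; rewrite -normr_le0 -u0 le_norm_enorm.
Qed.

Lemma dotv_sq_le u v : dotv u v ^+ 2 <= dotv u u * dotv v v.
Proof.
have [v0|v_neq0] := eqVneq (dotv v v) 0.
  have -> : v = 0 by apply: enorm_eq0; rewrite /enorm v0 sqrtr0.
  by rewrite -(scale0r (0 : 'rV[R]_n)) !dotvZr !mul0r expr0n mulr0.
have v_gt0 : 0 < dotv v v by rewrite lt0r v_neq0 dotv_ge0.
have := dotv_ge0 (dotv v v *: u - dotv u v *: v).
rewrite dotvD_sq !dotvE => h.
by rewrite -subr_ge0 -(pmulr_rge0 _ v_gt0); move: h; congr (0 <= _); ring.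
Qed.

Lemma dotv_sq_continuous : continuous (fun u => dotv u u).
Proof.
move=> u; apply: (@cvg_sum _ _ _ _ _ (nbhs_filter u)) => i.
by apply: cvgM; exact: coord_continuous.
Qed.

Lemma enorm_continuous : continuous (@enorm R n).
Proof.
move=> u; apply: continuous_comp; first exact: dotv_sq_continuous.
exact: sqrt_continuous.
Qed.

Lemma near_enorm_lt u c : 0 < c -> \forall v \near u, enorm (v - u) < c.
Proof.
move=> c0; have /cvgrPdist_lt /(_ _ c0) := @enorm_continuous 0.
rewrite enorm0 => /nbhs_ballP [e /= e0 he].
apply: filterS (near_ball u e e0) => v; rewrite -ball_normE /= => uv.
have : ball 0 e (v - u) by rewrite -ball_normE /ball_ /= sub0r normrN distrC.
by move=> /he /=; rewrite sub0r normrN ger0_norm ?enorm_ge0.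
Qed.

End EuclideanSpace.

Section PairVectors.
Context {R : realType} {n : nat}.
Implicit Types (u v : 'rV[R]_n) (a b : R).

Lemma pairvB u v a b : pairv u a - pairv v b = pairv (u - v) (a - b).
Proof. by rewrite /pairv opp_row_mx add_row_mx raddfB. Qed.

Lemma pairvZ c u a : c *: pairv u a = pairv (c *: u) (c * a).
Proof. by rewrite /pairv scale_row_mx scale_scalar_mx. Qed.

Lemma dotv_pairv u v a b : dotv (pairv u a) (pairv v b) = dotv u v + a * b.
Proof.
rewrite /dotv big_split_ord/= big_ord1 !row_mxEr !mxE eqxx !mulr1n.
by congr (_ + _); apply: eq_bigr => i _; rewrite !row_mxEl.
Qed.

Lemma enorm_pairv_le u a : enorm (pairv u a) <= enorm u + `|a|.
Proof.
rewrite -ler_sqr ?nnegrE ?addr_ge0 ?enorm_ge0// sqr_enorm dotv_pairv sqrrD.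
rewrite sqr_enorm -expr2 -(real_normK (num_real a)).
by have := enorm_ge0 u; have := normr_ge0 a; nra.
Qed.

End PairVectors.

(** * Proximal normals *)

Section ProximalNormals.
Context {R : realType}.

(** Quadratic majorants of a minimized function produce normals with this
    quadratic error, which is stronger than the epsilon-normal inequality for
    every positive epsilon. *)
Definition proximal_normal {n} (S : set 'rV[R]_n) (x z : 'rV[R]_n) : Prop :=
  exists C : R, \forall u \near x,
    S u -> dotv z (u - x) <= C * dotv (u - x) (u - x).

(** Closeness rather than sequences: a cluster point of approximate normals can
    then be used without extracting a subsequence. *)
Definition limiting_proximal_normal {n} (S : set 'rV[R]_n) (x z : 'rV[R]_n) :
    Prop :=
  forall e : R, 0 < e -> exists x' z' : 'rV[R]_n,
    [/\ S x', `|x' - x| < e, `|z' - z| < e & proximal_normal S x' z'].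

Lemma proximal_eps_normals {n} (S : set 'rV[R]_n) x z (e : R) :
  0 < e -> proximal_normal S x z -> eps_normals e x S z.
Proof.
move=> e0 [C hC]; rewrite /eps_normals /= /limf_esup.
pose A := [set u : 'rV[R]_n | dotv z (u - x) / enorm (u - x) <= e].
apply: (@le_trans _ _
  (ereal_sup ((fun u => (dotv z (u - x) / enorm (u - x))%:E) @` A))).
  apply: ereal_inf_lbound; exists A => //.
  change (\forall u \near x, u != x -> S u -> A u).
  have d0 : 0 < e / (`|C| + 1) by rewrite divr_gt0// ltr_wpDl.
  apply: filterS2 hC (near_enorm_lt x _ d0) => u hu hux ux Su.
  have N0 : 0 < enorm (u - x).
    rewrite lt0r enorm_ge0 andbT; apply/eqP => /enorm_eq0 /eqP.
    by rewrite subr_eq0 (negPf ux).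
  rewrite /A /= ler_pdivrMr//; apply: le_trans (hu Su) _.
  rewrite -sqr_enorm expr2 mulrA ler_pM2r//.
  move: hux; rewrite ltr_pdivlMr ?ltr_wpDl// => hux.
  have : C <= `|C| by exact: ler_norm.
  nra.
by apply: ge_ereal_sup => _ [u Au <-]; rewrite lee_fin.
Qed.

Lemma limiting_proximal_normal_cone {n} (S : set 'rV[R]_n) x z :
  limiting_proximal_normal S x z -> normal_cone x S z.
Proof.
move=> h.
have /choice [p hp] : forall k : nat, exists p : 'rV[R]_n * 'rV[R]_n,
    [/\ S p.1, `|p.1 - x| < k.+1%:R^-1, `|p.2 - z| < k.+1%:R^-1 &
      proximal_normal S p.1 p.2].
  move=> k; have [|x' [z' [? ? ? ?]]] := h k.+1%:R^-1.
    by rewrite invr_gt0.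
  by exists (x', z').
have to_limit (q : nat -> 'rV[R]_n) y :
    (forall k, `|q k - y| < k.+1%:R^-1) -> q @ \oo --> y.
  move=> qy; apply/cvgrPdist_lt => e e0.
  near=> k; rewrite distrC; apply: lt_trans (qy k) _.
  by near: k; exact: near_infty_natSinv_lt (PosNum e0).
exists (fun k => (p k).1), (fun k => k.+1%:R^-1), (fun k => (p k).2); split.
- by split => [|k]; [apply: to_limit => k|]; have [] := hp k.
- split => [|k]; last by rewrite invr_gt0.
  exact: cvg_harmonic.
- by apply: to_limit => k; have [] := hp k.
- move=> k; have [_ _ _] := hp k.
  by apply: proximal_eps_normals; rewrite invr_gt0.
Unshelve. all: end_near. Qed.

Lemma proximal_normalZ {n} (S : set 'rV[R]_n) x z (c : R) :
  0 <= c -> proximal_normal S x z -> proximal_normal S x (c *: z).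
Proof.
move=> c0 [C hC]; exists (c * C); apply: filterS hC => u h Su.
by rewrite dotvZl -mulrA ler_wpM2l// h.
Qed.

(** Positive homogeneity turns a normal [(v, - lam)] to an epigraph into
    [(v / lam, - 1)], that is, into a subgradient. *)
Lemma limiting_proximal_normalZ {n} (S : set 'rV[R]_n) x z (c : R) :
  0 < c -> limiting_proximal_normal S x z ->
  limiting_proximal_normal S x (c *: z).
Proof.
move=> c0 h e e0.
have [|x' [z' [Sx' xx' zz' pz']]] := h (Num.min e (e / c)).
  by rewrite lt_min e0 divr_gt0.
move: xx' zz'; rewrite !lt_min => /andP[xx' _] /andP[_ zz'].
exists x', (c *: z'); split => //; last exact: proximal_normalZ (ltW c0) pz'.
by rewrite -scalerBr normrZ gtr0_norm// mulrC -ltr_pdivlMr.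
Qed.

(** Moving from y by [t *: v] costs at most [L * t * enorm v] in height; the
    resulting point of the epigraph, as t tends to 0, bounds v.  The bound by
    lam, not only by L, forces v to vanish with its multiplier. *)
Lemma proximal_normal_epi_le {n} (phi : 'rV[R]_n -> R) (L lam : R)
    (y v : 'rV[R]_n) :
  0 <= L -> 0 <= lam ->
  (\forall u \near y, `|phi u - phi y| <= L * enorm (u - y)) ->
  proximal_normal (epi phi) (pairv y (phi y)) (pairv v (- lam)) ->
  enorm v <= L * lam.
Proof.
move=> L0 lam0 hL [C /nbhs_ballP [e /= e0 hC]].
have [v0|v_neq0] := eqVneq (enorm v) 0; first by rewrite v0 mulr_ge0.
have V0 : 0 < enorm v by rewrite lt0r v_neq0 enorm_ge0.
have /nbhs_ballP [d /= d0 hd] := hL.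
rewrite leNgt; apply/negP => hlt.
set V := enorm v in v_neq0 V0 hlt *.
(* The displacement tested below has norm at most [t * M], and [C'] absorbs
   the quadratic error of the normal inequality. *)
pose M := V * (1 + L).
have M0 : 0 < M by rewrite mulr_gt0// ltr_pwDl//.
pose C' := `|C| * M * (1 + L) + 1.
have L1 : 0 < 1 + L by rewrite ltr_pwDl.
have C'0 : 0 < C' by rewrite ltr_wpDl// !mulr_ge0// ltW.
have [t [t0 tM tV tC]] : exists t : R,
    [/\ 0 < t, t * M < e, t * V < d & t * C' < V - L * lam].
  pose m := Num.min (Num.min (e / M) (d / V)) ((V - L * lam) / C').
  have m0 : 0 < m by rewrite !lt_min !divr_gt0// subr_gt0.
  have : m / 2 < m by lra.
  rewrite {2}/m !lt_min !ltr_pdivlMr// => /andP[/andP[? ?] ?].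
  by exists (m / 2); split => //; lra.
pose a := phi y + t * (L * V).
have yt : y + t *: v - y = t *: v by rewrite addrC addKr.
have Et : enorm (t *: v) = t * V by rewrite enormZ gtr0_norm.
have dy : `|phi (y + t *: v) - phi y| <= L * (t * V).
  have := hd (y + t *: v); rewrite /= yt Et; apply.
  rewrite -ball_normE /= distrC yt.
  by apply: le_lt_trans (le_norm_enorm _) _; rewrite Et.
have dp : pairv (y + t *: v) a - pairv y (phi y) = pairv (t *: v) (t * (L * V)).
  by rewrite pairvB yt /a addrC addKr.
have := hC (pairv (y + t *: v) a).
rewrite dp !dotv_pairv dotvZl !dotvZr -sqr_enorm -/V.
suff [h1 h2] : [/\ ball (pairv y (phi y)) e (pairv (y + t *: v) a) &
    epi phi (pairv (y + t *: v) a)].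
  move=> /(_ h1 h2) h.
  have tV0 : 0 < t * V by rewrite mulr_gt0.
  have : t * V * (V - L * lam) <= t * V * (t * (C' - 1)).
    apply: (@le_trans _ _ (C * ((t * V) ^+ 2 * (1 + L ^+ 2)))).
      by move: h; lra.
    apply: (@le_trans _ _ (`|C| * ((t * V) ^+ 2 * (1 + L) ^+ 2))).
      have p0 : 0 <= (t * V) ^+ 2 * (1 + L ^+ 2).
        by rewrite mulr_ge0 ?sqr_ge0// addr_ge0 ?sqr_ge0.
      apply: (@le_trans _ _ (`|C| * ((t * V) ^+ 2 * (1 + L ^+ 2)))).
        by rewrite ler_wpM2r// ler_norm.
      by rewrite ler_wpM2l// ler_wpM2l ?sqr_ge0//; nra.
    by rewrite le_eqVlt; apply/orP; left; apply/eqP; rewrite /C' /M; ring.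
  by rewrite ler_pM2l//; lra.
split.
  rewrite -ball_normE /= distrC dp.
  apply: le_lt_trans (le_norm_enorm _) _.
  apply: le_lt_trans (enorm_pairv_le _ _) _.
  rewrite Et ger0_norm ?mulr_ge0 ?(ltW t0) ?(ltW V0)//.
  by move: tM; rewrite /M; lra.
exists (y + t *: v, a) => //=.
by move: dy; rewrite ler_distl /a => /andP[_]; lra.
Qed.

End ProximalNormals.

(** * Locally Lipschitz functions *)

Section LocallyLipschitz.
Context {R : realType} {n : nat}.

Lemma locally_lipschitz_ball (phi : 'rV[R]_n -> R) (x : 'rV[R]_n) :
  locally_lipschitz phi -> exists L d : R, [/\ 0 <= L, 0 < d &
    forall u v, ball x d u -> ball x d v ->
      `|phi u - phi v| <= L * enorm (u - v)].
Proof.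
move=> /(_ x) [k [[A B] /= [/nbhs_ballP [d /= d0 dA] xB] AB]].
have /nbhs_ballP [d' /= d'0 d'B] := xB.
exists `|k|, (Num.min d d'); split => // [|u v xu xv].
  by rewrite lt_min d0.
have /= : `|phi u - phi v| <= k * enorm (u - v).
  apply: (AB (u, v)); split => /=.
    by apply: dA; apply: le_ball xu; rewrite ge_min lexx.
  by apply: d'B; apply: le_ball xv; rewrite ge_min lexx orbT.
by move=> /le_trans; apply; rewrite ler_wpM2r ?enorm_ge0// ler_norm.
Qed.

Lemma locally_lipschitz_continuous (phi : 'rV[R]_n -> R) :
  locally_lipschitz phi -> continuous phi.
Proof.
move=> hphi x; have [L [d [L0 d0 hL]]] := locally_lipschitz_ball phi x hphi.
apply/(@cvgrPdist_lt _ _ _ _ (nbhs_filter x)) => e e0.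
have c0 : 0 < e / (L + 1) by rewrite divr_gt0// ltr_wpDl.
apply: filterS2 (near_ball x d d0) (near_enorm_lt x _ c0) => u xu.
rewrite ltr_pdivlMr ?ltr_wpDl// => h.
have := hL u x xu (ballxx _ d0); rewrite distrC => /le_lt_trans; apply.
by have := enorm_ge0 (u - x); nra.
Qed.

Lemma locally_lipschitz_uniform (J : finType) (phi : J -> 'rV[R]_n -> R)
    (x : 'rV[R]_n) :
  (forall j, locally_lipschitz (phi j)) ->
  exists L d : R, [/\ 0 <= L, 0 < d &
    forall j u v, ball x d u -> ball x d v ->
      `|phi j u - phi j v| <= L * enorm (u - v)].
Proof.
move=> hphi.
have /choice [p hp] j : exists p : R * R, [/\ 0 <= p.1, 0 < p.2 &
    forall u v, ball x p.2 u -> ball x p.2 v ->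
      `|phi j u - phi j v| <= p.1 * enorm (u - v)].
  by have [L [d ?]] := locally_lipschitz_ball _ x (hphi j); exists (L, d).
have L0 : 0 <= \sum_j (p j).1 by apply: sumr_ge0 => j _; have [] := hp j.
have : \forall u \near x, forall j, ball x (p j).2 u.
  apply: (@filter_forall _ J (fun j => ball x (p j).2) _ (nbhs_filter x)) => j.
  by apply: nbhsx_ballx; have [] := hp j.
move=> /nbhs_ballP [d /= d0 hd].
exists (\sum_j (p j).1), d; split => // j u v xu xv.
have [pj0 _ /(_ u v (hd u xu j) (hd v xv j))] := hp j.
move=> /le_trans; apply; rewrite ler_wpM2r ?enorm_ge0//.
rewrite (bigD1 j)//= lerDl; apply: sumr_ge0 => i _.
by have [] := hp i.
Qed.

End LocallyLipschitz.

(** * A smooth majorant of the Euclidean norm *)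

Section SmoothedNorm.
Context {R : realType} {n : nat}.
Variable e : R.
Hypothesis e_gt0 : 0 < e.
Implicit Types u w : 'rV[R]_n.

Definition smooth_norm u : R := Num.sqrt (dotv u u + e ^+ 2).

Lemma sqr_smooth_norm u : smooth_norm u ^+ 2 = dotv u u + e ^+ 2.
Proof. by rewrite sqr_sqrtr// addr_ge0 ?dotv_ge0 ?sqr_ge0. Qed.

Lemma smooth_norm_ge u : e <= smooth_norm u.
Proof.
rewrite -(ler_sqr (ltW e_gt0) (sqrtr_ge0 _)) sqr_smooth_norm.
by rewrite lerDr dotv_ge0.
Qed.

Lemma smooth_norm_gt0 u : 0 < smooth_norm u.
Proof. exact: lt_le_trans (smooth_norm_ge u). Qed.

Lemma enorm_le_smooth_norm u : enorm u <= smooth_norm u.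
Proof. by rewrite ler_wsqrtr// lerDl sqr_ge0. Qed.

Lemma smooth_norm0 : smooth_norm 0 = e.
Proof.
by rewrite /smooth_norm -sqr_enorm enorm0 expr0n add0r sqrtr_sqr gtr0_norm.
Qed.

Lemma smooth_norm_continuous : continuous smooth_norm.
Proof.
move=> u; apply: continuous_comp; last exact: sqrt_continuous.
apply: (@cvgD _ _ _ _ (nbhs_filter u) (fun v => dotv v v) (cst (e ^+ 2))).
  exact: dotv_sq_continuous.
exact: cvg_cst.
Qed.

Definition smooth_grad w : 'rV[R]_n := (smooth_norm w)^-1 *: w.

Lemma enorm_smooth_grad w : enorm (smooth_grad w) <= 1.
Proof.
have w0 := smooth_norm_gt0 w.
rewrite enormZ gtr0_norm ?invr_gt0// mulrC ler_pdivrMr// mul1r.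
exact: enorm_le_smooth_norm.
Qed.

(** Concavity of the square root: the tangent line of the square root at
    [smooth_norm w ^+ 2] lies above it. *)
Lemma smooth_norm_majorant w u :
  smooth_norm u - smooth_norm w <=
  dotv (smooth_grad w) (u - w) + (2 * smooth_norm w)^-1 * dotv (u - w) (u - w).
Proof.
have w0 := smooth_norm_gt0 w.
have hu := sqr_smooth_norm u; have hw := sqr_smooth_norm w.
have hd := dotvD_sq w (u - w); rewrite addrC subrK in hd.
rewrite dotvZl -(ler_pM2l w0).
set a := smooth_norm u in hu *; set b := smooth_norm w in w0 hw *.
have -> : b * (b^-1 * dotv w (u - w) + (2 * b)^-1 * dotv (u - w) (u - w)) =
    dotv w (u - w) + dotv (u - w) (u - w) / 2.
  by field; rewrite gt_eqF.
have := sqr_ge0 (a - b); move: hu hw hd.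
by rewrite !expr2; lra.
Qed.

Lemma smooth_norm_majorant_sq w u : dotv (u - w) (u - w) <= 1 ->
  (dotv (smooth_grad w) (u - w) +
   (2 * smooth_norm w)^-1 * dotv (u - w) (u - w)) ^+ 2 <=
  2 * (1 + e^-1 ^+ 2) * dotv (u - w) (u - w).
Proof.
move=> d1; set d := u - w in d1 *; set k := (2 * _)^-1.
have d0 := dotv_ge0 d.
have hk : 0 <= k <= e^-1.
  have w0 := smooth_norm_gt0 w; have hw := smooth_norm_ge w.
  apply/andP; split; first by rewrite /k invr_ge0 mulr_ge0// ltW.
  by rewrite /k lef_pV2 ?posrE ?mulr_gt0//; lra.
have /andP[k0 ke] := hk.
have k2 : k ^+ 2 <= e^-1 ^+ 2 by rewrite ler_sqr ?nnegrE// (le_trans k0).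
have := dotv_sq_le (smooth_grad w) d.
have : dotv (smooth_grad w) (smooth_grad w) <= 1.
  by rewrite -sqr_enorm expr_le1 ?enorm_ge0 ?enorm_smooth_grad.
set g := dotv (smooth_grad w) (smooth_grad w); set p := dotv _ d.
move=> g1 hp.
have hp1 : p ^+ 2 <= dotv d d by apply: le_trans hp _; rewrite ler_piMl.
have hq : (k * dotv d d) ^+ 2 <= e^-1 ^+ 2 * dotv d d.
  rewrite exprMn ler_pM ?sqr_ge0//.
  by rewrite expr2 ler_piMl.
have := sqr_ge0 (p - k * dotv d d).
by move: hp1 hq; rewrite !expr2; lra.
Qed.

End SmoothedNorm.

(** * The penalized problem *)

(** The squared positive part is convex with slope [2 * max a 0] at [a] and
    second-order remainder at most [T ^+ 2]; monotonicity lets [T] be any upper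
    bound of the increment. *)
Lemma max0_sq_majorant {R : realType} (a t T : R) : t <= T ->
  Num.max (a + t) 0 ^+ 2 <=
  Num.max a 0 ^+ 2 + 2 * Num.max a 0 * T + T ^+ 2.
Proof.
move=> tT; have -> : Num.max a 0 ^+ 2 + 2 * Num.max a 0 * T + T ^+ 2 =
  (Num.max a 0 + T) ^+ 2 by ring.
have [at0|at0] := leP (a + t) 0; first by rewrite expr0n sqr_ge0.
have : a <= Num.max a 0 by rewrite le_max lexx.
by move=> h; rewrite ler_sqr ?nnegrE; lra.
Qed.

Section PenalizedProblem.
Context {R : realType} {n : nat} {J : finType}.
Variables (phi : J -> 'rV[R]_n -> R) (r : J -> R) (xbar : 'rV[R]_n).
Variables (K e : R).
Hypotheses (r_ge0 : forall j, 0 <= r j) (K_ge0 : 0 <= K) (e_gt0 : 0 < e).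
Implicit Types (x u : 'rV[R]_n) (y : J -> 'rV[R]_n).

(** Where some [phi j x - phi j xbar + r j * enorm (x - xbar)] is nonnegative,
    the summand e makes the excess at least of order e for every value [a] close
    to [phi j x]. *)
Definition excess j x (a : R) : R :=
  a - phi j xbar + r j * smooth_norm e (x - xbar) + e.

Definition pos_excess j x u : R := Num.max (excess j x (phi j u)) 0.

(** The last term only localizes x; at a minimizer its gradient
    [2 * e *: (x - xbar)] is of smaller order than the positive parts, which are
    of order e. *)
Definition penalty x y : R :=
  \sum_j (pos_excess j x (y j) ^+ 2 + K * dotv (y j - x) (y j - x)) +
  e * dotv (x - xbar) (x - xbar).

Lemma pos_excess_ge0 j x u : 0 <= pos_excess j x u.
Proof. by rewrite le_max lexx orbT. Qed.

(** The normal is minus half the gradient of [penalty] in x. *)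
Lemma proximal_normal_feasible (S : set 'rV[R]_n) x y :
  (\forall u \near x, S u -> penalty x y <= penalty u y) ->
  proximal_normal S x
    (- ((\sum_j pos_excess j x (y j) * r j) *: smooth_grad e (x - xbar) +
        K *: \sum_j (x - y j) + e *: (x - xbar))).
Proof.
move=> hmin.
set b := smooth_grad e _.
pose k := (2 * smooth_norm e (x - xbar))^-1.
pose s j := pos_excess j x (y j).
pose C j := 2 * s j * r j * k + r j ^+ 2 * (2 * (1 + e^-1 ^+ 2)) + K.
exists ((\sum_j C j + e) / 2).
apply: filterS2 hmin (near_enorm_lt x 1 ltr01) => u hmin ux Su.
set d := u - x; have ud : u = x + d by rewrite /d addrC subrK.
have dd1 : dotv d d <= 1 by rewrite -sqr_enorm expr_le1 ?enorm_ge0// ltW.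
have dd0 := dotv_ge0 d.
pose T := dotv b d + k * dotv d d.
have xux : u - xbar - (x - xbar) = d by rewrite opprB addrA subrK.
have tT : smooth_norm e (u - xbar) - smooth_norm e (x - xbar) <= T.
  by have := smooth_norm_majorant e e_gt0 (x - xbar) (u - xbar); rewrite xux.
have TT : T ^+ 2 <= 2 * (1 + e^-1 ^+ 2) * dotv d d.
  have := smooth_norm_majorant_sq e e_gt0 (x - xbar) (u - xbar).
  by rewrite xux; apply.
have hj j : pos_excess j u (y j) ^+ 2 + K * dotv (y j - u) (y j - u) <=
    s j ^+ 2 + K * dotv (y j - x) (y j - x) +
    (2 * (s j * r j) * dotv b d + 2 * K * dotv (x - y j) d +
     C j * dotv d d).
  have := @max0_sq_majorant _ (excess j x (phi j (y j)))
    (r j * (smooth_norm e (u - xbar) - smooth_norm e (x - xbar))) (r j * T)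
    (ler_wpM2l (r_ge0 j) tT).
  have -> : excess j x (phi j (y j)) +
    r j * (smooth_norm e (u - xbar) - smooth_norm e (x - xbar)) =
    excess j u (phi j (y j)) by rewrite /excess; ring.
  rewrite -/(pos_excess j u (y j)) -/(pos_excess j x (y j)) -/(s j).
  have -> : y j - u = (y j - x) + - d by rewrite ud opprD addrA.
  rewrite dotvD_sq !dotvNr !dotvNl -(opprB (y j) x) !dotvNl exprMn /C.
  have : r j ^+ 2 * T ^+ 2 <= r j ^+ 2 * (2 * (1 + e^-1 ^+ 2) * dotv d d).
    by rewrite ler_wpM2l ?sqr_ge0.
  by rewrite /T; lra.
rewrite dotvNl 2!dotvDl 3!dotvZl dotv_suml.
have := hmin Su; rewrite /penalty.
have -> : u - xbar = (x - xbar) + d by rewrite -xux [RHS]addrC subrK.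
rewrite (dotvD_sq (x - xbar)) => h.
have le_pen :=
  le_trans h (lerD (ler_sum _ (fun j (_ : true) => hj j)) (lexx _)).
rewrite !big_split/= -!mulr_suml -!mulr_sumr in le_pen.
by move: le_pen; rewrite /s; lra.
Qed.

(** The penalty is nondecreasing in the value of [phi j], so minimality on the
    graph of [phi j] extends to its epigraph. *)
Lemma proximal_normal_epi x y j :
  (\forall u \near y j, penalty x y <= penalty x (dfwith y j u)) ->
  proximal_normal (epi (phi j)) (pairv (y j) (phi j (y j)))
    (pairv (- K *: (y j - x)) (- pos_excess j x (y j))).
Proof.
move=> /nbhs_ballP [d /= d0 hd].
exists ((1 + K) / 2).
apply: filterS (near_enorm_lt _ _ d0) => p hp [[u a] /= ua pE].
rewrite -{}pE pairvB in hp *.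
have yu : ball (y j) d u.
  rewrite -ball_normE /= distrC; apply: le_lt_trans (le_norm_enorm _) _.
  apply: le_lt_trans hp; rewrite ler_wsqrtr// dotv_pairv lerDl.
  by rewrite -expr2 sqr_ge0.
have := hd _ yu; rewrite /penalty lerD2r (bigD1 j)//= [leRHS](bigD1 j)//=.
rewrite [X in _ <= _ + X -> _](eq_bigr (fun i => pos_excess i x (y i) ^+ 2 +
   K * dotv (y i - x) (y i - x))); last first.
  by move=> i ij; rewrite dfwithout // eq_sym.
rewrite lerD2r dfwithin => h.
have := @max0_sq_majorant _ (excess j x (phi j (y j))) (phi j u - phi j (y j))
    (a - phi j (y j)) (lerB ua (lexx _)).
have -> : excess j x (phi j (y j)) + (phi j u - phi j (y j)) =
  excess j x (phi j u) by rewrite /excess; ring.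
rewrite -/(pos_excess j x u) -/(pos_excess j x (y j)) => h2.
have := dotvD_sq (y j - x) (u - y j).
have -> : y j - x + (u - y j) = u - x by rewrite addrC addrA subrK.
rewrite !dotv_pairv dotvZl => h3; rewrite h3 in h.
have := dotv_ge0 (u - y j).
have := sqr_ge0 (a - phi j (y j)).
rewrite expr2 in h2 *; move: h h2.
set q := dotv (u - y j) (u - y j); set t := a - _.
move=> h h2 t0 q0.
have : 0 <= K * (t * t) by rewrite mulr_ge0.
by lra.
Qed.

End PenalizedProblem.

(** * Approximate multipliers *)

Section ApproximateMultipliers.
Context {R : realType} {n : nat} {J : finType}.
Variables (phi : J -> 'rV[R]_n -> R) (r : J -> R).
Variables (S : set 'rV[R]_n) (xbar : 'rV[R]_n).
Hypotheses (phi_lip : forall j, locally_lipschitz (phi j)).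
Hypotheses (r_ge0 : forall j, 0 <= r j).
Hypotheses (S_closed : closed S) (S_xbar : S xbar).

Lemma compact_norm_ball (rho : R) :
  compact [set u : 'rV[R]_n | `|u - xbar| <= rho].
Proof.
apply: bounded_closed_compact.
  exists (`|xbar| + rho); split; first exact: num_real.
  move=> M hM u /= hu; apply: le_trans (ltW hM).
  rewrite -{1}(subrK xbar u) addrC; apply: le_trans (ler_normD _ _) _.
  by rewrite lerD2l.
apply: (preimage_closed (f := fun u : 'rV[R]_n => `|u - xbar|)
  (D := [set a : R | a <= rho])); last exact: closed_le.
move=> u _; apply: (cvg_comp (fun u => u - xbar)); last exact: norm_continuous.
exact: (@cvgB _ _ _ _ (nbhs_filter u) id (cst xbar) _ _ cvg_id (cvg_cst _)).
Qed.

(** Confining x and the copies to a ball gives a compact product; the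
    minimizers used below are interior to that ball. *)
Lemma penalty_minimizer (K e rho : R) : 0 < e -> 0 <= rho ->
  exists x y, [/\ S x, `|x - xbar| <= rho, forall j, `|y j - xbar| <= rho &
    forall x' y', S x' -> `|x' - xbar| <= rho ->
      (forall j, `|y' j - xbar| <= rho) ->
      penalty phi r xbar K e x y <= penalty phi r xbar K e x' y'].
Proof.
move=> e0 rho0.
pose B := [set u : 'rV[R]_n | `|u - xbar| <= rho].
pose Y := prod_topology (fun _ : J => 'rV[R]_n).
pose A := (B `&` S) `*` ([set y | forall j, B (y j)] : set Y).
have cA : compact A.
  apply: compact_setX; first exact: compact_closedI (compact_norm_ball rho) _.
  exact: (@tychonoff J (fun=> 'rV[R]_n) (fun=> B)
    (fun=> compact_norm_ball rho)).
pose h (p : 'rV[R]_n * Y) := penalty phi r xbar K e p.1 p.2.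
have hc : continuous h.
  move=> p.
  have c1 : q.1 @[q --> p] --> p.1 by exact: cvg_fst.
  have c2 j : (q.2 j : 'rV[R]_n) @[q --> p] --> (p.2 j : 'rV[R]_n).
    apply: (cvg_comp (fun q : 'rV[R]_n * Y => q.2) (fun y : Y => y j)).
      exact: cvg_snd.
    exact: (@proj_continuous J (fun=> 'rV[R]_n) j).
  have cx : q.1 - xbar @[q --> p] --> p.1 - xbar.
    exact: (cvgB c1 (cvg_cst xbar)).
  have sq (f : 'rV[R]_n * Y -> 'rV[R]_n) a : f q @[q --> p] --> a ->
      dotv (f q) (f q) @[q --> p] --> dotv a a.
    by move=> fa; exact: (cvg_comp f _ fa (@dotv_sq_continuous _ _ a)).
  rewrite /h /penalty; apply: cvgD.
    apply: cvg_sum => j; apply: cvgD; last first.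
      apply: cvgM; first exact: cvg_cst.
      by apply: sq; apply: cvgB.
    have cm : pos_excess phi r xbar e j q.1 (q.2 j) @[q --> p] -->
        pos_excess phi r xbar e j p.1 (p.2 j).
      apply: (@cvg_comp _ _ _
        (fun q => excess phi r xbar e j q.1 (phi j (q.2 j)))
        (fun a : R => Num.max a 0) _
        (nbhs (excess phi r xbar e j p.1 (phi j (p.2 j))))).
        rewrite /excess; apply: cvgD; last exact: cvg_cst.
        apply: cvgD.
          apply: cvgB; last exact: cvg_cst.
          apply: (cvg_comp _ (phi j) (c2 j)).
          exact: (locally_lipschitz_continuous _ (phi_lip j)).
        apply: cvgM; first exact: cvg_cst.
        apply: (cvg_comp _ (smooth_norm e) cx).
        exact: smooth_norm_continuous.
      by apply: (@continuous_max _ _ id (cst 0)); [exact: cvg_id|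
        exact: cvg_cst].
    rewrite expr2; under eq_cvg do rewrite expr2.
    exact: cvgM.
  apply: cvgM; first exact: cvg_cst.
  exact: sq.
have A0 : A !=set0.
  by exists (xbar, fun=> xbar); rewrite /A /B /=; split => //= [|_];
    rewrite ?subrr ?normr0.
have [[x y] xyA hmin] := compact_EVT_min A0 cA (continuous_subspaceT hc).
move: xyA; rewrite inE => -[[/= xB xS] yB].
exists x, y; split => // x' y' Sx' x'B y'B.
by apply: (hmin (x', y')); rewrite inE.
Qed.

Variables (L d : R).
Hypotheses (L_ge0 : 0 <= L) (d_gt0 : 0 < d).
Hypothesis phi_L : forall j u v, ball xbar d u -> ball xbar d v ->
  `|phi j u - phi j v| <= L * enorm (u - v).
Hypothesis phi_max : forall x, S x ->
  exists j, 0 <= phi j x - phi j xbar + r j * enorm (x - xbar).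

(** The data are one function on [option J], so that compactness of a product
    applies to all of them at once: the value at [Some j] is the pair of the
    vector [v j] and the multiplier of [phi j], and the value at [None] holds
    the vector of the unit ball. *)
Definition approximate_multipliers (tau : R) (q : option J -> 'rV[R]_n * R) :
    Prop :=
  (forall j, exists y, `|y - xbar| < tau /\
    proximal_normal (epi (phi j)) (pairv y (phi j y))
      (pairv (q (Some j)).1 (- (q (Some j)).2))) /\
  exists x w, [/\ S x, `|x - xbar| < tau, proximal_normal S x w &
    `|w + (\sum_j (q (Some j)).1 +
           (\sum_j (q (Some j)).2 * r j) *: (q None).1)| < tau].

(** The second component at [None] carries no information; fixing it keeps the
    set compact. *)
Definition multiplier_simplex : set (option J -> 'rV[R]_n * R) :=
  [set q | [/\ forall j, 0 <= (q (Some j)).2, \sum_j (q (Some j)).2 = 1,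
    forall j, enorm (q (Some j)).1 <= L * (q (Some j)).2,
    enorm (q None).1 <= 1 & (q None).2 = 0]].

(** Comparison with [x = xbar], [y j = xbar] bounds the penalty at a minimizer
    by [C * e ^+ 2].  Hence [x] is within [sqrt (C * e)] of [xbar], and the
    choice of K makes [L * enorm (y j - x)] at most [e / 2].  As some function
    is nonnegative at x, its excess is then at least [e / 2], so that dividing
    by the sum of the positive parts leaves an error of size
    [2 * enorm (x - xbar)]. *)
Lemma exists_approximate_multipliers (tau : R) : 0 < tau ->
  exists2 q, multiplier_simplex q & approximate_multipliers tau q.
Proof.
move=> tau0.
pose C := \sum_j (1 + r j) ^+ 2.
have C0 : 0 <= C by apply: sumr_ge0 => j _; exact: sqr_ge0.
pose K := 4 * L ^+ 2 * C + 1.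
have K1 : 1 <= K by rewrite lerDr !mulr_ge0 ?sqr_ge0.
have K0 : 0 < K by exact: lt_le_trans K1.
(* All points below lie within [2 * sigma] of [xbar], and [4 * sigma] is at
   most the radius [d / 2] of the ball in which the penalty is minimized. *)
pose sigma := Num.min tau d / 8.
have m0 : 0 < Num.min tau d by rewrite lt_min tau0.
have mtau : Num.min tau d <= tau by rewrite ge_min lexx.
have md : Num.min tau d <= d by rewrite ge_min lexx orbT.
have sigma0 : 0 < sigma by rewrite divr_gt0.
have sigma_tau : 8 * sigma <= tau by rewrite /sigma; lra.
have sigma_d : 8 * sigma <= d by rewrite /sigma; lra.
have [e [e0 e1 Ce]] : exists e : R, [/\ 0 < e, e <= 1 & C * e < sigma ^+ 2].
  exists (Num.min 1 (sigma ^+ 2 / (C + 1))).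
  have q0 : 0 < sigma ^+ 2 / (C + 1).
    by rewrite divr_gt0 ?exprn_gt0// ltr_wpDl.
  split; [by rewrite lt_min ltr01|by rewrite ge_min lexx|].
  apply: (@le_lt_trans _ _ (C * (sigma ^+ 2 / (C + 1)))).
    by rewrite ler_wpM2l// ge_min lexx orbT.
  rewrite mulrA ltr_pdivrMr ?ltr_wpDl// mulrC ltr_pM2l ?exprn_gt0//.
  by rewrite ltrDl.
have d2 : 0 <= d / 2 by rewrite divr_ge0// ltW.
have [x [y [Sx xB yB xy_min]]] := penalty_minimizer K e (d / 2) e0 d2.
pose s j := pos_excess phi r xbar e j x (y j).
have s0 j : 0 <= s j by exact: pos_excess_ge0.
have pen_le : penalty phi r xbar K e x y <= C * e ^+ 2.
  apply: le_trans (xy_min xbar (fun=> xbar) S_xbar _ _) _.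
  - by rewrite subrr normr0.
  - by move=> j; rewrite subrr normr0.
  rewrite /penalty subrr -sqr_enorm enorm0 expr0n !mulr0 addr0 /C mulr_suml.
  apply: ler_sum => j _; rewrite addr0 /pos_excess /excess subrr add0r.
  rewrite subrr smooth_norm0// -exprMn.
  have re : 0 <= (1 + r j) * e by rewrite mulr_ge0 ?addr_ge0// ltW.
  have -> : r j * e + e = (1 + r j) * e by ring.
  by rewrite (max_idPl re).
have term0 j : 0 <= s j ^+ 2 + K * dotv (y j - x) (y j - x).
  by rewrite addr_ge0 ?sqr_ge0// mulr_ge0 ?dotv_ge0// ltW.
have ex0 : 0 <= e * dotv (x - xbar) (x - xbar).
  by rewrite mulr_ge0 ?dotv_ge0// ltW.
have x_le : e * dotv (x - xbar) (x - xbar) <= C * e ^+ 2.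
  apply: le_trans pen_le; rewrite /penalty lerDr.
  by apply: sumr_ge0 => j _; exact: term0.
have y_le j : K * dotv (y j - x) (y j - x) <= C * e ^+ 2.
  apply: le_trans pen_le; rewrite /penalty -[leLHS]addr0 lerD//.
  rewrite (bigD1 j)//= -[leLHS]addr0; apply: lerD.
    by rewrite lerDr sqr_ge0.
  by apply: sumr_ge0 => i _; exact: term0.
have lt_sigma (u : 'rV[R]_n) : dotv u u <= C * e -> enorm u < sigma.
  move=> hu; rewrite -ltr_sqr ?nnegrE ?enorm_ge0 ?ltW// sqr_enorm.
  exact: le_lt_trans Ce.
have x_sigma : enorm (x - xbar) < sigma.
  by apply: lt_sigma; rewrite -(ler_pM2l e0); move: x_le; rewrite expr2; lra.
have y_sigma j : enorm (y j - x) < sigma.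
  apply: lt_sigma; have := y_le j; have := dotv_ge0 (y j - x).
  set q := dotv _ _ => q0 h.
  have : q <= K * q by rewrite ler_peMl.
  have : e ^+ 2 <= e by rewrite expr2 ler_piMl// ltW.
  by nra.
have xn : `|x - xbar| < sigma by exact: le_lt_trans (le_norm_enorm _) _.
have yn j : `|y j - xbar| < 2 * sigma.
  have -> : y j - xbar = (y j - x) + (x - xbar) by rewrite addrA subrK.
  apply: le_lt_trans (ler_normD _ _) _.
  have := le_lt_trans (le_norm_enorm _) (y_sigma j); move: xn; lra.
have x_in : ball xbar d x by rewrite -ball_normE /= distrC; lra.
have y_in j : ball xbar d (y j).
  by rewrite -ball_normE /= distrC; apply: lt_le_trans (yn j) _; lra.
have Ly j : L * enorm (y j - x) <= e / 2.
  rewrite -ler_sqr ?nnegrE; last 2 first.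
  - by rewrite mulr_ge0 ?enorm_ge0.
  - by rewrite divr_ge0 ?(ltW e0).
  rewrite exprMn sqr_enorm.
  have := y_le j; have := dotv_ge0 (y j - x).
  set q := dotv _ _ => q0 h.
  have [C_eq0|C_neq0] := eqVneq C 0.
    have q00 : q = 0.
      apply/eqP; rewrite eq_le q0 andbT -(ler_pM2l K0) mulr0.
      by move: h; rewrite C_eq0 mul0r.
    by rewrite q00 mulr0 sqr_ge0.
  have Cp : 0 < C by rewrite lt0r C_neq0.
  rewrite -(ler_pM2l Cp).
  by move: h; rewrite /K; lra.
pose sig := \sum_j s j.
have sig_ge : e / 2 <= sig.
  have [j hj] := phi_max x Sx.
  apply: (@le_trans _ _ (s j)); last first.
    by rewrite /sig (bigD1 j)//= lerDl sumr_ge0.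
  rewrite /s /pos_excess le_max; apply/orP; left; rewrite /excess.
  have := phi_L j _ _ (y_in j) x_in; rewrite ler_distl => /andP[h _].
  have := Ly j; have : r j * enorm (x - xbar) <= r j * smooth_norm e (x - xbar).
    by rewrite ler_wpM2l// enorm_le_smooth_norm.
  by move: hj h; lra.
have sig0 : 0 < sig by apply: lt_le_trans sig_ge; rewrite divr_gt0.
have sigV0 : 0 <= sig^-1 by rewrite invr_ge0 ltW.
pose b := smooth_grad e (x - xbar).
pose q (o : option J) : 'rV[R]_n * R :=
  if o is Some j then (sig^-1 *: (- K *: (y j - x)), sig^-1 * s j) else (b, 0).
have normal_epi j : proximal_normal (epi (phi j)) (pairv (y j) (phi j (y j)))
    (pairv (q (Some j)).1 (- (q (Some j)).2)).
  rewrite /= -mulrN -pairvZ; apply: proximal_normalZ => //.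
  apply: (proximal_normal_epi _ r) (ltW K0) _ _ _ _ => //.
  apply: filterS (near_ball (y j) sigma sigma0) => u.
  rewrite -ball_normE /= => hu; apply: xy_min => // i.
  have [->|ij] := eqVneq i j; last by rewrite dfwithout // eq_sym.
  rewrite dfwithin -(subrK (y j) u) -addrA.
  apply: le_trans (ler_normD _ _) _.
  by have := yn j; move: hu; rewrite distrC; lra.
exists q; split => //=.
- by move=> j; rewrite mulr_ge0.
- by rewrite -mulr_sumr mulVf// gt_eqF.
- move=> j; apply:
    (proximal_normal_epi_le (phi j) L (sig^-1 * s j) (y j)) => //.
    by rewrite mulr_ge0.
  have hd : 0 < d - 2 * sigma by lra.
  apply: filterS (near_ball (y j) _ hd) => u; rewrite -ball_normE /= => hu.
  apply: phi_L => //; rewrite -ball_normE /= distrC -(subrK (y j) u) -addrA.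
  apply: le_lt_trans (ler_normD _ _) _.
  by have := yn j; move: hu; rewrite distrC; lra.
- exact: enorm_smooth_grad.
- by move=> j; exists (y j); split => //; apply: lt_le_trans (yn j) _; lra.
exists x, (sig^-1 *: - ((\sum_j s j * r j) *: b + K *: \sum_j (x - y j) +
  e *: (x - xbar))); split => //.
- by lra.
- apply: proximal_normalZ => //; apply: proximal_normal_feasible => //.
  apply: filterS (near_ball x sigma sigma0) => u.
  rewrite -ball_normE /= => hu Su; apply: xy_min => //.
  rewrite -(subrK x u) -addrA; apply: le_trans (ler_normD _ _) _.
  by move: hu xn; rewrite distrC; lra.
have -> : sig^-1 *: - ((\sum_j s j * r j) *: b + K *: \sum_j (x - y j) +
    e *: (x - xbar)) + (\sum_j sig^-1 *: (- K *: (y j - x)) +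
    (\sum_j sig^-1 * s j * r j) *: b) = - (sig^-1 * e) *: (x - xbar).
  have -> : \sum_j sig^-1 *: (- K *: (y j - x)) =
      sig^-1 *: (K *: \sum_j (x - y j)).
    rewrite !scaler_sumr; apply: eq_bigr => j _.
    by rewrite scaleNr -scalerN opprB.
  have -> : \sum_j sig^-1 * s j * r j = sig^-1 * \sum_j s j * r j.
    by rewrite mulr_sumr; apply: eq_bigr => j _; rewrite mulrA.
  rewrite scaleNr -!scalerA -!scalerDr -scalerN; congr (_ *: _).
  by rewrite opprD addrC addrA (addrC (K *: _)) subrr sub0r.
rewrite normrZ normrN gtr0_norm ?mulr_gt0 ?invr_gt0//.
have : sig^-1 * e <= 2 by rewrite mulrC ler_pdivrMr//; lra.
have := normr_ge0 (x - xbar); nra.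
Qed.

End ApproximateMultipliers.

(** * The multiplier rule *)

Lemma norm_pairv_lt {R : realType} {n : nat} (u : 'rV[R]_n) (a e : R) :
  `|u| < e -> `|a| < e -> `|pairv u a| < e.
Proof.
move=> ue ae; rewrite [ltLHS]/Num.norm/= mx_normrE; apply/bigmax_ltP.
split=> [|[i j] _] /=; first exact: le_lt_trans ae.
rewrite ord1 mxE; case: splitP => k _; last by rewrite !ord1 mxE eqxx mulr1n.
apply: le_lt_trans ue; rewrite [leRHS]/Num.norm/= mx_normrE.
by apply/bigmax_geP; right; exists (0, k).
Qed.

Section MultiplierRule.
Context {R : realType} {n : nat} {J : finType}.

Lemma compact_multiplier_simplex (L : R) : 0 <= L ->
  @compact (prod_topology (fun _ : option J => ('rV[R]_n * R)%type))
    (multiplier_simplex L).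
Proof.
move=> L0; pose Q := prod_topology (fun _ : option J => ('rV[R]_n * R)%type).
set A := multiplier_simplex L : set Q.
have c1 o (p : Q) : (q o).1 @[q --> p] --> (p o).1.
  apply: (@cvg_comp _ _ _ (fun q : Q => q o) fst _ (nbhs (p o))).
    exact: (@proj_continuous _ (fun=> ('rV[R]_n * R)%type) o).
  exact: cvg_fst.
have c2 o (p : Q) : (q o).2 @[q --> p] --> (p o).2.
  apply: (@cvg_comp _ _ _ (fun q : Q => q o) snd _ (nbhs (p o))).
    exact: (@proj_continuous _ (fun=> ('rV[R]_n * R)%type) o).
  exact: cvg_snd.
have ce o (p : Q) : enorm (q o).1 @[q --> p] --> enorm (p o).1.
  exact: (cvg_comp _ _ (c1 o p) (@enorm_continuous _ _ (p o).1)).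
have cl (f : Q -> R) : (forall p : Q, f q @[q --> p] --> f p) ->
    (forall q, A q -> 0 <= f q) ->
    forall p, closure A p -> 0 <= f p.
  move=> fc fA p Ap.
  have fcl : closed (f @^-1` [set a | 0 <= a]).
    by apply: preimage_closed; [move=> q _; exact: fc|exact: closed_ge].
  exact/fcl/(closureS fA).
have Acl : closed A.
  move=> p Ap; split.
  - move=> j; apply: (cl (fun q => (q (Some j)).2)) Ap => [q|q []//].
    exact: c2.
  - have cs (q' : Q) :
        \sum_j (q (Some j)).2 @[q --> q'] --> \sum_j (q' (Some j)).2.
      by apply: (@cvg_sum _ _ _ _ _ (nbhs_filter q')) => j; exact: c2.
    apply/eqP; rewrite eq_le -subr_ge0 -[X in _ && X]subr_ge0.
    apply/andP; split.
      apply: (cl (fun q => 1 - \sum_j (q (Some j)).2)) Ap => [q|q [_ -> _ _ _]].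
        by apply: (@cvgB _ _ _ _ (nbhs_filter q)); [exact: cvg_cst|exact: cs].
      by rewrite subrr.
    apply: (cl (fun q => \sum_j (q (Some j)).2 - 1)) Ap => [q|q [_ -> _ _ _]].
      by apply: (@cvgB _ _ _ _ (nbhs_filter q)); [exact: cs|exact: cvg_cst].
    by rewrite subrr.
  - move=> j; rewrite -subr_ge0.
    apply: (cl (fun q => L * (q (Some j)).2 - enorm (q (Some j)).1)) Ap.
      move=> q; apply: (@cvgB _ _ _ _ (nbhs_filter q)); last exact: ce.
      by apply: (@cvgM _ _ _ (nbhs_filter q)); [exact: cvg_cst|exact: c2].
    by move=> q [_ _ h _ _]; rewrite subr_ge0.
  - rewrite -subr_ge0; apply: (cl (fun q => 1 - enorm (q None).1)) Ap.
      move=> q; apply: (@cvgB _ _ _ _ (nbhs_filter q)); last exact: ce.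
      exact: cvg_cst.
    by move=> q [_ _ _ h _]; rewrite subr_ge0.
  - apply/eqP; rewrite eq_le -[X in X && _]oppr_ge0; apply/andP; split.
      apply: (cl (fun q => - (q None).2)) Ap => [q|q [_ _ _ _ ->]].
        by apply: (@cvgN _ _ _ _ (nbhs_filter q)); exact: c2.
      by rewrite oppr0.
    by apply: (cl (fun q => (q None).2)) Ap => [q|q [_ _ _ _ ->]//]; exact: c2.
apply: (subclosed_compact Acl).
  apply: (@tychonoff (option J) (fun=> ('rV[R]_n * R)%type) (fun=>
    [set u : 'rV[R]_n | `|u - 0| <= L + 1] `*` `[0, 1]%classic)) => _.
  by apply: compact_setX; [exact: compact_norm_ball|exact: segment_compact].
move=> q [q0 q1 qL qN qN2] [j|] /=; rewrite subr0 in_itv /=.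
  have qj1 : (q (Some j)).2 <= 1.
    by rewrite -q1 (bigD1 j)//= lerDl sumr_ge0.
  rewrite q0 qj1; split => //; apply: le_trans (le_norm_enorm _) _.
  apply: le_trans (qL j) _; apply: (@le_trans _ _ L); last by rewrite lerDl.
  by rewrite ler_piMr.
rewrite qN2 lexx ler01; split => //; apply: le_trans (le_norm_enorm _) _.
by apply: le_trans qN _; rewrite lerDr.
Qed.

Variables (phi : J -> 'rV[R]_n -> R) (r : J -> R).
Variables (S : set 'rV[R]_n) (xbar : 'rV[R]_n).
Hypotheses (phi_lip : forall j, locally_lipschitz (phi j)).
Hypotheses (r_ge0 : forall j, 0 <= r j).
Hypotheses (S_closed : closed S) (S_xbar : S xbar).
Hypothesis phi_max : forall x, S x ->
  exists j, 0 <= phi j x - phi j xbar + r j * enorm (x - xbar).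

(** A cluster point of approximate multipliers of tolerance tending to 0. *)
Lemma exists_limiting_multipliers :
  exists (lam : J -> R) (v : J -> 'rV[R]_n) (b : 'rV[R]_n),
    [/\ forall j, 0 <= lam j, \sum_j lam j = 1, enorm b <= 1,
      forall j, (lam j = 0 -> v j = 0) /\
        limiting_proximal_normal (epi (phi j)) (pairv xbar (phi j xbar))
          (pairv (v j) (- lam j)) &
      limiting_proximal_normal S xbar
        (- (\sum_j v j + (\sum_j lam j * r j) *: b))].
Proof.
have [L [d [L0 d0 phi_L]]] := locally_lipschitz_uniform J phi xbar phi_lip.
pose Q := prod_topology (fun _ : option J => ('rV[R]_n * R)%type).
have /choice [q hq] (k : nat) : exists q : Q, multiplier_simplex L q /\
    approximate_multipliers phi r S xbar k.+1%:R^-1 q.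
  have [|q q1 q2] := exists_approximate_multipliers phi r S xbar phi_lip r_ge0
    S_closed S_xbar L d L0 d0 phi_L phi_max k.+1%:R^-1.
    by rewrite invr_gt0.
  by exists q.
have [p [[p0 p1 pL pN _] pq]] : (multiplier_simplex L : set Q) `&`
    cluster (q @ \oo) !=set0.
  apply: compact_multiplier_simplex => //.
  by exists 0%N => // k _; have [] := hq k.
have near_p (t : R) (U : set Q) : 0 < t -> nbhs p U ->
    exists2 q', U q' & approximate_multipliers phi r S xbar t q'.
  move=> t0 pU.
  have [|q' [[k hk <-] Uq]] :=
    pq [set q' | exists2 k, k.+1%:R^-1 < t & q k = q'] U _ pU.
    have [N _ hN] := near_infty_natSinv_lt (PosNum t0).
    by exists N => // k /hN kt; exists k.
  exists (q k) => //; have [_ [h1 [x [w [Sx xx xw ww]]]]] := hq k; split.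
    move=> j; have [y [yx yn]] := h1 j.
    by exists y; split=> //; exact: lt_trans hk.
  by exists x, w; split => //; exact: lt_trans hk.
have FFp : Filter (nbhs (p : Q)) := nbhs_filter _.
have c1 o : (q' o).1 @[q' --> (p : Q)] --> (p o).1.
  apply: (@cvg_comp _ _ _ (fun q : Q => q o) fst _ (nbhs (p o))).
    exact: (@proj_continuous _ (fun=> ('rV[R]_n * R)%type) o).
  exact: cvg_fst.
have c2 o : (q' o).2 @[q' --> (p : Q)] --> (p o).2.
  apply: (@cvg_comp _ _ _ (fun q : Q => q o) snd _ (nbhs (p o))).
    exact: (@proj_continuous _ (fun=> ('rV[R]_n * R)%type) o).
  exact: cvg_snd.
exists (fun j => (p (Some j)).2), (fun j => (p (Some j)).1), (p None).1.
split=> // [j|].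
  split.
    move=> pj0; apply: enorm_eq0; apply/eqP; rewrite eq_le enorm_ge0 andbT.
    by have := pL j; rewrite pj0 mulr0.
  move=> e e0.
  have /cvgrPdist_lt /(_ e e0) hphi :=
    locally_lipschitz_continuous _ (phi_lip j) xbar.
  have [t /= t0 ht] : exists2 t : R, 0 < t &
      forall y, `|y - xbar| < t -> `|phi j y - phi j xbar| < e.
    move: hphi => /nbhs_ballP [t /= t0 ht]; exists t => // y hy.
    by rewrite distrC; apply: ht; rewrite -ball_normE /= distrC.
  have /cvgrPdist_lt /(_ e e0) U1 := c1 (Some j).
  have /cvgrPdist_lt /(_ e e0) U2 := c2 (Some j).
  have te0 : 0 < Num.min t e by rewrite lt_min t0.
  have [q' [u1 u2] [/(_ j) [y [yx yn]] _]] := near_p _ _ te0 (filterI U1 U2).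
  move: yx; rewrite lt_min => /andP[yt ye].
  exists (pairv y (phi j y)), (pairv (q' (Some j)).1 (- (q' (Some j)).2)).
  split=> //.
  - by exists (y, phi j y) => /=.
  - by rewrite pairvB; apply: norm_pairv_lt => //; exact: ht.
  - by rewrite pairvB; apply: norm_pairv_lt; [rewrite distrC|
      rewrite opprK addrC].
move=> e e0.
pose G (q' : Q) := \sum_j (q' (Some j)).1 +
  (\sum_j (q' (Some j)).2 * r j) *: (q' None).1.
have cG : G q' @[q' --> (p : Q)] --> G p.
  apply: cvgD; first by apply: cvg_sum => j; exact: c1.
  apply: cvgZ; last exact: c1.
  by apply: cvg_sum => j; apply: cvgM; [exact: c2|exact: cvg_cst].
have e2 : 0 < e / 2 by rewrite divr_gt0.
have /cvgrPdist_lt /(_ _ e2) uG := cG.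
have [q' u [_ [x [w [Sx xx xw ww]]]]] :=
  near_p _ _ e2 uG.
exists x, w; split => //; first by lra.
rewrite opprK -/(G p) -(subrK (G q') (G p)) (addrC (_ - _)) addrA.
apply: le_lt_trans (ler_normD _ _) _.
by move: u ww => /=; rewrite -/(G q'); lra.
Qed.

End MultiplierRule.

(** Over a singleton, a single function has multiplier 1, and its normal vector
    is a subgradient. *)
Lemma subdiff_nonempty {R : realType} {n : nat} (phi : 'rV[R]_n -> R) x :
  locally_lipschitz phi -> subdiff phi x !=set0.
Proof.
move=> hphi.
have [|||||lam [v [b [lam0 lam1 _ hv _]]]] :=
  @exists_limiting_multipliers R n unit (fun=> phi) (fun=> 0) [set x] x => //.
- exact: accessible_closed_set1 (hausdorff_accessible (@norm_hausdorff _ _)) _.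
- by move=> _ ->; exists tt; rewrite !subrr enorm0 mulr0 addr0.
have l1 : lam tt = 1 by rewrite -lam1 (bigD1 tt)//= big1 ?addr0// => -[].
exists (v tt); apply: limiting_proximal_normal_cone.
by have [_] := hv tt; rewrite l1.
Qed.

(** First-order necessary condition for [xbar] to minimize over S the maximum of
    the functions [phi j x - phi j xbar + r j * enorm (x - xbar)]. *)
Lemma multiplier_rule {R : realType} {n : nat} {J : finType}
    (phi : J -> 'rV[R]_n -> R) (r : J -> R) (S : set 'rV[R]_n) xbar :
  (forall j, locally_lipschitz (phi j)) -> (forall j, 0 <= r j) ->
  closed S -> S xbar ->
  (forall x, S x -> exists j,
    0 <= phi j x - phi j xbar + r j * enorm (x - xbar)) ->
  exists (lam : J -> R) (v : J -> 'rV[R]_n) (b : 'rV[R]_n),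
    [/\ forall j, 0 <= lam j, \sum_j lam j = 1, eball R n b,
      forall j, (lam j [*:] subdiff (phi j) xbar) (v j) &
      normal_cone xbar S (- (\sum_j v j + (\sum_j lam j * r j) *: b))].
Proof.
move=> phi_lip r0 Scl Sx hmax.
have [lam [v [b [lam0 lam1 b1 hv hS]]]] :=
  exists_limiting_multipliers phi r S xbar phi_lip r0 Scl Sx hmax.
exists lam, v, b; split=> //; last exact: limiting_proximal_normal_cone.
move=> j; have [hv0 hvj] := hv j.
have [l0|l_neq0] := eqVneq (lam j) 0.
  have [z hz] := subdiff_nonempty _ xbar (phi_lip j).
  by exists z => //; rewrite l0 hv0// scale0r.
have l0 : 0 < lam j by rewrite lt0r l_neq0 lam0.
exists ((lam j)^-1 *: v j); last by rewrite scalerA divff// scale1r.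
rewrite /subdiff /=.
have -> : pairv ((lam j)^-1 *: v j) (-1) = (lam j)^-1 *: pairv (v j) (- lam j).
  by rewrite pairvZ mulrN mulVf.
apply/limiting_proximal_normal_cone/limiting_proximal_normalZ => //.
by rewrite invr_gt0.
Qed.

(** * Necessary conditions for quasi-weakly Pareto solutions *)

Section SetSums.
Context {R : realType} {V : lmodType R}.

Lemma set_add_sum (J : finType) (A : J -> set V) (a : J -> V) :
  (forall j, A j (a j)) ->
  (\big[set_add/[set 0]]_j A j : set V) (\sum_j a j).
Proof.
move=> Aa; elim/big_ind2 : _ => // x X y Y hx hy.
by exists x => //; exists y.
Qed.

End SetSums.
Theorem theorem3p4 (R : realType) (n m : nat) (T : Type)
  (f : 'I_m -> 'rV[R]_n -> cinterval R) (g : T -> 'rV[R]_n -> R)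
  (Omega : set 'rV[R]_n) (E : 'I_m -> cinterval R) (xbar : 'rV[R]_n)
  (hfL : forall i, locally_lipschitz (fun x => lo (f i x)))
  (hfU : forall i, locally_lipschitz (fun x => hi (f i x)))
  (hg : forall t, locally_lipschitz (g t))
  (hOmega0 : Omega !=set0) (hOmega : closed Omega)
  (hE : forall i, 0 <= lo (E i))
  (hxbar : feasible g Omega xbar)
  (hLCQ : LCQ g Omega xbar)
  (hsol : type2_quasi_weakly_pareto f g Omega E xbar) :
  exists lamL lamU : 'I_m -> R,
    [/\ forall i, 0 <= lamL i, forall i, 0 <= lamU i,
        \sum_(i < m) (lamL i + lamU i) = 1 &
        exists2 mu : T -> R, active_multipliers g xbar mu &
          (\big[set_add/[set 0]]_(i < m)
             (lamL i [*:] subdiff (fun x => lo (f i x)) xbar [+]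
              lamU i [*:] subdiff (fun x => hi (f i x)) xbar) [+]
           sum_subdiff g mu xbar [+]
           (\sum_(i < m) (lamL i * hi (E i) + lamU i * lo (E i)))
             [*:] eball R n [+]
           normal_cone xbar Omega) 0].
Proof.
pose phi (j : 'I_m + 'I_m) x := match j with
  | inl i => lo (f i x) | inr i => hi (f i x) end.
pose r (j : 'I_m + 'I_m) := match j with
  | inl i => hi (E i) | inr i => lo (E i) end.
have phi_lip j : locally_lipschitz (phi j) by case: j.
have r_ge0 j : 0 <= r j.
  by case: j => i /=; rewrite ?(le_trans (hE i) (lo_le_hi _)).
have F_closed : closed (feasible g Omega).
  have -> : feasible g Omega =
      Omega `&` \bigcap_t (g t @^-1` [set a | a <= 0]).
    by apply/seteqP; split=> x [xO xg]; split => // t; [move=> _|]; exact: xg.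
  apply: closedI => //; apply: closed_bigI => t _.
  apply: preimage_closed; last exact: closed_le.
  by move=> x _; exact: (locally_lipschitz_continuous _ (hg t)).
have [_ no_better] := hsol.
have phi_max x : feasible g Omega x ->
    exists j, 0 <= phi j x - phi j xbar + r j * enorm (x - xbar).
  move=> Fx; apply: contrapT => all_lt; apply: no_better; exists x; split => //.
  have lt0 j : phi j x - phi j xbar + r j * enorm (x - xbar) < 0.
    by rewrite ltNge; apply/negP => h; apply: all_lt; exists j.
  move=> i; split => /=; [have := lt0 (inl i)|have := lt0 (inr i)] => /=; lra.
have [lam [v [b [lam0 lam1 b1 hv hN]]]] :=
  multiplier_rule phi r (feasible g Omega) xbar phi_lip r_ge0 F_closed hxbar
    phi_max.
have [s [mu muA smu] [w hw sw]] := hLCQ _ hN.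
exists (fun i => lam (inl i)), (fun i => lam (inr i)); split => //.
  by rewrite -lam1 big_sumType big_split.
exists mu => //.
have sum_v : \sum_j v j = \sum_(i < m) (v (inl i) + v (inr i)).
  by rewrite big_sumType big_split.
have sum_r : \sum_j lam j * r j =
    \sum_(i < m) (lam (inl i) * hi (E i) + lam (inr i) * lo (E i)).
  by rewrite big_sumType big_split.
rewrite -sum_r.
exists (\sum_j v j + s + (\sum_j lam j * r j) *: b); last first.
  by exists w => //; rewrite -addrA addrACA sw subrr.
exists (\sum_j v j + s); last first.
  by exists ((\sum_j lam j * r j) *: b) => //; exists b.
exists (\sum_j v j); last by exists s.
rewrite sum_v; apply: set_add_sum => i.
by exists (v (inl i)); [exact: hv|exists (v (inr i)); [exact: hv|]].
Qed.
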